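(* Let $n \ge 2$, let $k$ be a subfield of $\mathbb{R}$, and let $A_0A_1\cdots A_n$ be an $n$-simplex in $\mathbb{R}^n$ all of whose vertices lie in $k^n$. For each $i \in \{0,1,\dots,n\}$ let $a_i$ be the ($(n-1)$-dimensional) volume of the facet opposite to $A_i$ (so that $a_i^2 \in k^\times$). The following conditions are equivalent: (S1) The incenter $I$ of the simplex $A_0A_1\cdots A_n$ lies in $k^n$. (S2) $a_0^2 \equiv a_1^2 \equiv \cdots \equiv a_n^2 \pmod{k^{\times 2}}$. If $k/\mathbb{Q}$ is algebraic, these conditions are also equivalent to: (S2)$'$ There exists a positive element $d \in O_k$ such that $a_0^2 \equiv a_1^2 \equiv \cdots \equiv a_n^2 \equiv d \pmod{k^{\times 2}}$.
   Context: $k^{\times 2} = \{q^2 : q \in k^\times\}$; for $x,y \in k^\times$, $x \equiv y \pmod{k^{\times 2}}$ means $x/y \in k^{\times 2}$. When $k/\mathbb{Q}$ is algebraic, $O_k$ denotes the ring of algebraic integers of $k$. The incenter of an $n$-simplex is the center of its inscribed sphere (the point with barycentric coordinates $(a_0 : a_1 : \cdots : a_n)$). *)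

(* Defs.v *)
From HB Require Import structures.
From mathcomp Require Import all_boot all_order all_algebra.
From mathcomp Require Import all_classical all_reals all_analysis.

Set Implicit Arguments.
Unset Strict Implicit.
Unset Printing Implicit Defensive.

Import Order.TTheory GRing.Theory Num.Theory.

Local Open Scope classical_set_scope.
Local Open Scope ring_scope.

(* The norm `|x| provided by the library on 'rV[R]_n is the sup norm. *)
Definition enorm (R : realType) (n : nat) (x : 'rV[R]_n) : R :=
  Num.sqrt (\sum_(j < n) x 0 j ^+ 2).

Definition esphere (R : realType) (n : nat) (c : 'rV[R]_n) (r : R) :
    set 'rV[R]_n :=
  [set x | enorm (x - c) = r].

Definition box (R : realType) (m : nat) (l u : 'rV[R]_m) : set 'rV[R]_m :=
  [set x | forall j, l 0 j <= x 0 j <= u 0 j].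

Definition box_vol (R : realType) (m : nat) (l u : 'rV[R]_m) : R :=
  \prod_(j < m) (u 0 j - l 0 j).

(* Lebesgue outer measure on R^m (m >= 1); on Lebesgue measurable sets (in particular
   on compact sets) it is the m-dimensional Lebesgue measure. *)
Definition lebesgue_outer (R : realType) (m : nat) (E : set 'rV[R]_m) :
    \bar R :=
  ereal_inf [set v | exists l u : nat -> 'rV[R]_m,
    [/\ forall k j, l k 0 j <= u k 0 j,
        E `<=` \bigcup_k box (l k) (u k) &
        v = (\sum_(0 <= k <oo) (box_vol (l k) (u k))%:E)%E]].

(* v is the m-dimensional volume of F, a set lying in some m-dimensional
   affine subspace of R^n: the subspace is identified with R^m by an affine
   isometry y |-> p + y *m Q, where the rows of Q are orthonormal, and F is
   measured there. The value depends neither on the subspace nor on the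
   isometry. *)
Definition has_volume (R : realType) (n m : nat) (F : set 'rV[R]_n) (v : R) :
    Prop :=
  exists (p : 'rV[R]_n) (Q : 'M[R]_(m, n)),
    [/\ Q *m Q^T = 1%:M,
        F `<=` range (fun y : 'rV[R]_m => p + y *m Q) &
        lebesgue_outer ((fun y : 'rV[R]_m => p + y *m Q) @^-1` F) = v%:E].

Definition affinely_independent (R : realType) (n m : nat)
    (A : 'I_m -> 'rV[R]_n) : Prop :=
  forall c : 'I_m -> R,
    \sum_i c i = 0 -> \sum_i c i *: A i = 0 -> forall i, c i = 0.

Definition simplex (R : realType) (n m : nat) (A : 'I_m -> 'rV[R]_n) :
    set 'rV[R]_n :=
  [set x | exists c : 'I_m -> R,
    [/\ forall i, 0 <= c i, \sum_i c i = 1 & x = \sum_i c i *: A i]].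

Definition facet (R : realType) (n : nat) (A : 'I_n.+1 -> 'rV[R]_n)
    (i : 'I_n.+1) : set 'rV[R]_n :=
  simplex (fun j : 'I_n => A (lift i j)).

(* A sphere contained in the simplex and tangent to (that is, touching in a
   single point) each of the facets. *)
Definition inscribed_sphere (R : realType) (n : nat)
    (A : 'I_n.+1 -> 'rV[R]_n) (c : 'rV[R]_n) (r : R) : Prop :=
  [/\ 0 < r, esphere c r `<=` simplex A &
      forall i, exists p, esphere c r `&` facet A i = [set p]].

Definition is_incenter (R : realType) (n : nat) (A : 'I_n.+1 -> 'rV[R]_n)
    (c : 'rV[R]_n) : Prop :=
  exists r : R, inscribed_sphere A c r.

(* Subfields k of R are represented by the library's divringClosed R: the
   predicates on R containing 1 and closed under subtraction and division. *)

Definition coords_in (R : realType) (k : divringClosed R) (n : nat)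
    (x : 'rV[R]_n) : Prop :=
  forall j, x 0 j \in k.

Definition nz_squares (R : realType) (k : divringClosed R) : set R :=
  [set q ^+ 2 | q in [set q : R | q \in k /\ q != 0]].

Definition eq_mod_squares (R : realType) (k : divringClosed R) (x y : R) :
    Prop :=
  nz_squares k (x / y).

Definition algebraic_over_Q (R : realType) (k : divringClosed R) : Prop :=
  forall x : R, x \in k -> algebraicOver (ratr : rat -> R) x.

Definition ring_of_integers (R : realType) (k : divringClosed R) : set R :=
  [set x : R | x \in k /\ integralOver (intmul 1 : int -> R) x].

(* Main.v *)
(* Let b_i be the barycentric coordinates of the simplex (affine functions with
   coefficients in k) and g_i in k^n the gradient of b_i. The distance from x to
   the i-th facet hyperplane is b_i(x) / |g_i|, so c is the incenter iff, for
   some r > 0, b_i(c) = r |g_i| for all i. Since the b_i(c) add up to 1, the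
   incenter has barycentric coordinates (|g_0| : ... : |g_n|) and lies in k^n
   iff all the ratios |g_i| / |g_j| lie in k. A Gram determinant computation
   gives a_i = |det M_i| |g_i| / (n-1)!, where the rows of M_i are edge vectors,
   so that det M_i lies in k; hence a_i^2 = |g_i|^2 modulo squares of k.

   The volume of a simplex is obtained from box covers alone. Cutting boxes into
   thin slabs shows that a linear map L multiplies the outer measure by at most
   |det L| (by an LU decomposition, L is a product of matrices that differ from
   a permutation matrix in at most one row); the same bound for L^-1 gives
   equality. For the standard simplex, counting grid cubes gives the upper bound
   1/m!, and the lower bound is by induction on m, integrating the slices. *)

Require Import Defs.
From HB Require Import structures.
From mathcomp Require Import all_boot all_order all_algebra.
From mathcomp Require Import all_classical all_reals all_analysis.
From mathcomp Require Import measurable_realfun fingroup perm ring.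

Import Order.TTheory GRing.Theory Num.Theory.
Import numFieldNormedType.Exports.

Local Open Scope classical_set_scope.
Local Open Scope ring_scope.

(** * Outer measure *)

Lemma box_vol_ge0 {R : realType} {m : nat} (l u : 'rV[R]_m) :
  (forall j, l 0 j <= u 0 j) -> 0 <= box_vol l u.
Proof. by move=> lu; apply: prodr_ge0 => j _; rewrite subr_ge0. Qed.

Lemma lebesgue_outer_le_series {R : realType} {m : nat} (E : set 'rV[R]_m)
    (l u : nat -> 'rV[R]_m) :
  (forall k j, l k 0 j <= u k 0 j) -> E `<=` \bigcup_k box (l k) (u k) ->
  (lebesgue_outer E <= \sum_(0 <= k <oo) (box_vol (l k) (u k))%:E)%E.
Proof. by move=> lu EB; apply: ereal_inf_lbound; exists l, u. Qed.

Lemma le_lebesgue_outer {R : realType} {m : nat} (E F : set 'rV[R]_m) :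
  E `<=` F -> (lebesgue_outer E <= lebesgue_outer F)%E.
Proof.
move=> EF; apply: ereal_inf_le_tmp => _ [l [u [lu FB ->]]].
by exists l, u; split => //; exact: subset_trans FB.
Qed.

Lemma lebesgue_outer_ge0 {R : realType} {m : nat} (E : set 'rV[R]_m) :
  (0 <= lebesgue_outer E)%E.
Proof.
apply: le_ereal_inf_tmp => _ [l [u [lu _ ->]]].
by apply: nneseries_ge0 => k _ _; rewrite lee_fin box_vol_ge0.
Qed.

Lemma lebesgue_outer_cover {R : realType} {m : nat} (E : set 'rV[R]_m)
    (e : R) : 0 < e -> lebesgue_outer E \is a fin_num ->
  exists l u : nat -> 'rV[R]_m,
    [/\ forall k j, l k 0 j <= u k 0 j, E `<=` \bigcup_k box (l k) (u k) &
        (\sum_(0 <= k <oo) (box_vol (l k) (u k))%:E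
           <= lebesgue_outer E + e%:E)%E].
Proof.
move=> e0 /(lb_ereal_inf_adherent e0)[_ [l [u [lu EB ->]]] /ltW lt_e].
by exists l, u.
Qed.

(** Each [F k] is covered up to an error [e / 2 ^ k.+1], and the double family of boxes is listed as
    one sequence through a bijection between [nat] and [nat * nat]. *)
Lemma lebesgue_outer_sigma_subadditive {R : realType} {m : nat}
    (F : nat -> set 'rV[R]_m) :
  (lebesgue_outer (\bigcup_k F k) <= \sum_(0 <= k <oo) lebesgue_outer (F k))%E.
Proof.
have [[i ioo]|] := pselect (exists i, lebesgue_outer (F i) = +oo%E).
  rewrite (eseries_pinfty _ _ ioo) ?leey// => n _.
  by rewrite -ltNye (lt_le_trans _ (lebesgue_outer_ge0 _)).
rewrite -forallNE => Foo; apply/lee_addgt0Pr => e e0.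
apply: le_trans (epsilon_trick _ (fun n => lebesgue_outer_ge0 (F n)) (ltW e0)).
pose P k (b : (nat -> 'rV[R]_m) * (nat -> 'rV[R]_m)) :=
  [/\ forall i j, b.1 i 0 j <= b.2 i 0 j,
      F k `<=` \bigcup_i box (b.1 i) (b.2 i) &
      (\sum_(0 <= i <oo) (box_vol (b.1 i) (b.2 i))%:E
         <= lebesgue_outer (F k) + (e / (2 ^ k.+1)%:R)%:E)%E].
have [G PG] : {G & forall k, P k (G k)}.
  apply: (@choice _ _ P) => k.
  have [] := lebesgue_outer_cover (F k) (e / (2 ^ k.+1)%:R).
  - by rewrite divr_gt0 // ltr0n expn_gt0.
  - by rewrite ge0_fin_numE ?lebesgue_outer_ge0 // ltey; apply/eqP.
  by move=> l [u Plu]; exists (l, u).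
pose v (x : nat * nat) := (box_vol ((G x.1).1 x.2) ((G x.1).2 x.2))%:E.
have v0 x : (0 <= v x)%E.
  by rewrite lee_fin box_vol_ge0 // => j; have [+ _ _] := PG x.1; apply.
apply: (@le_trans _ _ (\esum_(x in setT) v x)).
  have /card_esym/ppcard_eqP[f] := card_nat2.
  rewrite (reindex_esum setT setT f) //.
  rewrite -nneseries_esumT //.
  apply: lebesgue_outer_le_series => [k j|].
    by have [+ _ _] := PG (f k).1; apply.
  move=> x [k _ Fx]; have [_ /(_ x Fx) [i _ Bx] _] := PG k.
  by exists (f^-1%FUN (k, i)) => //=; rewrite !invK //; exact: mem_set.
rewrite -setXTT -(@esum_esum _ _ _ setT (fun=> setT)
  (fun i j => v (i, j))) //.
rewrite -nneseries_esumT; last by move=> k; exact: esum_ge0.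
apply: lee_nneseries => [k _ _|k _]; first exact: esum_ge0.
rewrite -nneseries_esumT //; by have [] := PG k.
Qed.

(* Fails in dimension 0: the boxes padding the finite family to a sequence would
   have volume 1 (empty product). *)
Lemma lebesgue_outer_le_sum {R : realType} {m : nat} {I : finType}
    (E : set 'rV[R]_m.+1) (l u : I -> 'rV[R]_m.+1) :
  (forall i j, l i 0 j <= u i 0 j) ->
  (forall x, E x -> exists i, box (l i) (u i) x) ->
  (lebesgue_outer E <= (\sum_i box_vol (l i) (u i))%:E)%E.
Proof.
move=> lu EB; pose s := map Some (enum I).
pose l' (o : option I) := if o is Some i then l i else 0.
pose u' (o : option I) := if o is Some i then u i else 0.
have vN : box_vol (l' None) (u' None) = 0.
  by rewrite /box_vol big_ord_recl /= mxE subrr mul0r.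
apply: (@le_trans _ _ (\sum_(0 <= k <oo)
    (box_vol (l' (nth None s k)) (u' (nth None s k)))%:E)%E).
  apply: lebesgue_outer_le_series => [k j|x /EB [i Bi]].
    by case: (nth _ _ _) => [i|] //=.
  exists (index i (enum I)) => //=.
  by rewrite (nth_map i) ?index_mem ?mem_enum // nth_index ?mem_enum.
rewrite (nneseries_split 0 (size s)); last first.
  by move=> k _; rewrite lee_fin box_vol_ge0 // => j; case: (nth _ _ _) => /=.
rewrite add0n eseries0 ?adde0; last first.
  by move=> k sk _; rewrite nth_default // vN.
rewrite sumEFin lee_fin -(big_nth None xpredT
  (fun o => box_vol (l' o) (u' o))) big_map.
by rewrite big_enum.
Qed.

(** The real bound [r] restricts the notion to sets of finite outer measure, so that no product of 0
    and +oo arises when [c = 0], and such bounds compose directly. *)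
Definition dilates_at_most {R : realType} {m : nat}
    (f : 'rV[R]_m -> 'rV[R]_m) (c : R) : Prop :=
  forall E r, (lebesgue_outer E <= r%:E -> lebesgue_outer (f @` E) <= (c * r)%:E)%E.

Lemma dilates_at_most_comp {R : realType} {m : nat}
    (f g : 'rV[R]_m -> 'rV[R]_m) (a b : R) :
  dilates_at_most f a -> dilates_at_most g b ->
  dilates_at_most (f \o g) (a * b).
Proof. by move=> fa gb E r Er; rewrite -image_comp -mulrA; exact/fa/gb. Qed.

(** The images of the boxes of a nearly optimal cover of [E] cover the image of [E], so
    sigma-subadditivity reduces the bound to boxes. *)
Lemma dilates_at_most_of_box {R : realType} {m : nat}
    (f : 'rV[R]_m -> 'rV[R]_m) (c : R) : 0 <= c ->
  (forall l u : 'rV[R]_m, (forall j, l 0 j <= u 0 j) ->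
     (lebesgue_outer (f @` box l u) <= (c * box_vol l u)%:E)%E) ->
  dilates_at_most f c.
Proof.
move=> c0 fB E r Er.
have fin : lebesgue_outer E \is a fin_num.
  by rewrite ge0_fin_numE ?lebesgue_outer_ge0 // (le_lt_trans Er) ?ltry.
apply/lee_addgt0Pr => e e0.
(* Dividing by [c + 1] instead of [c] keeps the error [c * (e / (c + 1))] at most [e] and allows
   [c = 0]. *)
have e'0 : 0 < e / (c + 1) by rewrite divr_gt0 // ltr_wpDl.
have [l [u [lu EB]]] := lebesgue_outer_cover E _ e'0 fin.
set S := (X in (X <= _)%E) => Sle.
apply: (@le_trans _ _ (lebesgue_outer (\bigcup_k (f @` box (l k) (u k))))).
  apply: le_lebesgue_outer => _ [x /EB [k _ Bx] <-].
  by exists k => //; exists x.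
apply: le_trans (lebesgue_outer_sigma_subadditive _) _.
apply: (@le_trans _ _ (c%:E * S)%E).
  rewrite -nneseriesZl; last by move=> k _; rewrite lee_fin box_vol_ge0.
  apply: lee_nneseries => [k _ _|k _]; first exact: lebesgue_outer_ge0.
  by rewrite -EFinM fB.
apply: (@le_trans _ _ (c%:E * (r + e / (c + 1))%:E)%E).
  apply: lee_wpmul2l; rewrite ?lee_fin //.
  by apply: le_trans Sle _; rewrite EFinD leeD2r.
rewrite -EFinM -EFinD lee_fin mulrDr lerD2l mulrCA ler_piMr //; first exact: ltW.
by rewrite ler_pdivrMr ?ltr_wpDl // mul1r lerDl.
Qed.

(** Serves to let the mesh of a subdivision tend to 0: the total volume of a cover is bounded by a
    polynomial in [1 / N.+1]. *)
Lemma ler_horner0 {R : realType} (p : {poly R}) (x : R) :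
  (forall N : nat, x <= p.[N.+1%:R^-1]) -> x <= p.[0].
Proof.
move=> xp.
have cp : (fun N : nat => p.[N.+1%:R^-1]) @ \oo --> p.[0].
  have := @continuous_horner R p 0.
  move/continuous_cvg => /(_ _ _ _ _ (@cvg_harmonic R)); exact.
by apply: (cvgr_to_ge cp); exact: nearW.
Qed.

(** * Linear maps *)

Definition row_subst_mx {R : realType} {m : nat} (k : 'I_m) (r : 'rV[R]_m) :
    'M[R]_m :=
  \matrix_(i, j) if i == k then r 0 j else (i == j)%:R.

Lemma mulmx_row_subst {R : realType} {m : nat} (k : 'I_m) (r x : 'rV[R]_m)
    (j : 'I_m) :
  (x *m row_subst_mx k r) 0 j = (j != k)%:R * x 0 j + x 0 k * r 0 j.
Proof.
rewrite mxE (bigD1 k) //= !mxE eqxx addrC; congr (_ + _).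
have [->|jk] := eqVneq j k.
  rewrite mul0r big1 // => i ik.
  by rewrite !mxE (negbTE ik) mulr0.
rewrite mul1r (bigD1 j) //= !mxE (negbTE jk) eqxx mulr1 big1 ?addr0 // => i.
by move=> /andP[ik ij]; rewrite !mxE (negbTE ik) (negbTE ij) mulr0.
Qed.

(* Cut the box into N slabs orthogonal to the k-th axis: up to an error O(1/N),
   each slab is mapped to a translate of a box scaled by r_k along that axis. *)
Lemma dilates_at_most_row_subst {R : realType} {m : nat} (k : 'I_m.+1)
    (r : 'rV[R]_m.+1) :
  dilates_at_most (fun x => x *m row_subst_mx k r) `|r 0 k|.
Proof.
apply: dilates_at_most_of_box => // l u lu.
pose w j := u 0 j - l 0 j.
have w0 j : 0 <= w j by rewrite subr_ge0.
(* At [1 / N.+1], [p] is the total volume of [N.+1] boxes of side [h * |r_k|] along axis [k] and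
   [w j + h * |r_j|] along the other axes; at 0 it is the wanted bound. *)
pose p : {poly R} := (`|r 0 k| * w k)%:P *
  \prod_(j | j != k) ((w j)%:P + (`|r 0 j| * w k) *: 'X).
have p0 : `|r 0 k| * box_vol l u = p.[0].
  rewrite hornerM hornerC horner_prod /box_vol (bigD1 k) //= mulrA.
  by congr (_ * _); apply: eq_bigr => j _; rewrite !hornerE.
set v := lebesgue_outer _.
suff vp N : (v <= (p.[N.+1%:R^-1])%:E)%E.
  have : v \is a fin_num.
    by rewrite ge0_fin_numE ?lebesgue_outer_ge0 // (le_lt_trans (vp 0%N)) ?ltry.
  move/fineK => vE; rewrite p0 -vE lee_fin; apply: ler_horner0 => N.
  by rewrite -lee_fin vE.
pose h := w k / N.+1%:R.
have h0 : 0 <= h by rewrite divr_ge0.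
pose c (t : 'I_N.+1) := l 0 k + t%:R * h.
(* On slab [t], [x_k] runs from [c t] to [c t + h], which bounds the image coordinate
   [x_j + x_k * r_j] (only [x_k * r_k] if [j = k]); [Num.min] and [Num.max] absorb the sign of
   [r_j]. *)
pose l' t : 'rV[R]_m.+1 :=
  \row_j ((j != k)%:R * l 0 j + c t * r 0 j + Num.min 0 (h * r 0 j)).
pose u' t : 'rV[R]_m.+1 :=
  \row_j ((j != k)%:R * u 0 j + c t * r 0 j + Num.max 0 (h * r 0 j)).
have u'l' t j : u' t 0 j - l' t 0 j = (j != k)%:R * w j + h * `|r 0 j|.
  rewrite !mxE /w.
  have -> : h * `|r 0 j| = Num.max 0 (h * r 0 j) - Num.min 0 (h * r 0 j).
    rewrite -{1}(ger0_norm h0) -normrM.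
    case: (leP 0 (h * r 0 j)) => [/ger0_norm -> |/ltr0_norm ->].
      by rewrite subr0.
    by rewrite sub0r.
  by ring.
have l'u' t j : l' t 0 j <= u' t 0 j.
  by rewrite -subr_ge0 u'l' addr_ge0 // mulr_ge0.
apply: le_trans (lebesgue_outer_le_sum _ l' u' l'u' _) _.
  move=> _ [x Bx <-].
  have [t /andP[ct1 ct2]] : exists t, c t <= x 0 k <= c t + h.
    (* Three cases: a flat box lies in slab 0; the right end [q = N.+1] belongs to the last slab;
       otherwise the integer part of [q] is the index. *)
    have [wk0|wk0] := eqVneq (w k) 0.
      have /andP[] := Bx k; move/eqP: wk0; rewrite subr_eq0 => /eqP -> x1 x2.
      exists ord0; rewrite /c mul0r addr0 x1.
      by rewrite (le_trans x2) // lerDl.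
    have hpos : 0 < h by rewrite divr_gt0 // lt_def wk0 w0.
    have /andP[x1 x2] := Bx k.
    pose q := (x 0 k - l 0 k) / h.
    have q0 : 0 <= q by rewrite divr_ge0 // subr_ge0.
    have qN : q <= N.+1%:R.
      rewrite ler_pdivrMr // mulrC divfK ?pnatr_eq0 // lerD2r.
      exact: x2.
    have xE : x 0 k = l 0 k + q * h.
      by rewrite divfK ?gt_eqF // addrC subrK.
    have [qeq|qne] := eqVneq q N.+1%:R.
      exists ord_max; rewrite /c xE qeq /=; apply/andP; split.
        by rewrite lerD2l ler_pM2r // ler_nat.
      by rewrite -addrA lerD2l -natr1 mulrDl mul1r.
    have tN : (Num.truncn q < N.+1)%N.
      rewrite -(ltr_nat R); apply: (@le_lt_trans _ _ q); first by rewrite truncn_le.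
      by rewrite lt_neqAle qne.
    exists (Ordinal tN); rewrite /c xE /= lerD2l ler_pM2r // truncn_le //=.
    rewrite -addrA lerD2l -[X in _ + X]mul1r -mulrDl natr1 ler_pM2r //.
    by rewrite q0 (ltW (truncnS_gt _)).
  exists t => j; rewrite mulmx_row_subst !mxE.
  have jkl : (j != k)%:R * l 0 j <= (j != k)%:R * x 0 j <= (j != k)%:R * u 0 j.
    by have /andP[? ?] := Bx j; rewrite !ler_wpM2l.
  have : c t * r 0 j + Num.min 0 (h * r 0 j) <= x 0 k * r 0 j <=
         c t * r 0 j + Num.max 0 (h * r 0 j).
    rewrite -lerBrDl -[X in _ && X]lerBlDl -mulrBl.
    have dx0 : 0 <= x 0 k - c t by rewrite subr_ge0.
    have dxh : x 0 k - c t <= h by rewrite lerBlDl.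
    have [r0|r0] := leP 0 (r 0 j).
      rewrite (min_l (mulr_ge0 h0 r0)) (max_r (mulr_ge0 h0 r0)).
      by rewrite mulr_ge0 //=; apply: ler_wpM2r.
    have hr : h * r 0 j <= 0 by rewrite mulr_ge0_le0 // ltW.
    rewrite (min_r hr) (max_l hr); apply/andP; split.
      by apply: ler_wnM2r => //; exact: ltW.
    by apply: mulr_ge0_le0 => //; exact: ltW.
  move=> /andP[? ?]; move: jkl => /andP[? ?].
  by rewrite -!addrA !lerD.
rewrite lee_fin /box_vol.
under eq_bigr => t _ do under eq_bigr => j _ do rewrite u'l'.
rewrite sumr_const card_ord (bigD1 k) //= eqxx mul0r add0r.
rewrite hornerM hornerC horner_prod -mulrnAl le_eqVlt; apply/orP; left; apply/eqP.
congr (_ * _).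
  by rewrite -mulr_natr /h; field.
apply: eq_bigr => j jk; rewrite jk mul1r !hornerE /h.
by ring.
Qed.

Lemma dilates_at_most_box_image {R : realType} {m : nat}
    (f : 'rV[R]_m.+1 -> 'rV[R]_m.+1) :
  (forall l u x : 'rV[R]_m.+1, box l u x -> box (f l) (f u) (f x)) ->
  (forall l u : 'rV[R]_m.+1, box_vol (f l) (f u) = box_vol l u) ->
  dilates_at_most f 1.
Proof.
move=> fB fv; apply: dilates_at_most_of_box => // l u lu.
rewrite mul1r -fv.
have := @lebesgue_outer_le_sum R m unit (f @` box l u) (fun=> f l) (fun=> f u).
rewrite big_const card_unit /= addr0; apply => [_ j|_ [x Bx <-]].
  by have /(_ j)/andP[+ _] : box (f l) (f u) (f l); [apply: fB => i; rewrite lexx lu|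
     have /(_ j)/andP[_ +] : box (f l) (f u) (f l); [apply: fB => i; rewrite lexx lu|]].
by exists tt; exact: fB.
Qed.

Lemma dilates_at_most_translate {R : realType} {m : nat} (v : 'rV[R]_m.+1) :
  dilates_at_most (+%R v) 1.
Proof.
apply: dilates_at_most_box_image => [l u x Bx j|l u].
  by rewrite !mxE !lerD2l; exact: Bx.
by apply: eq_bigr => j _; rewrite !mxE opprD addrACA subrr add0r.
Qed.

Lemma dilates_at_most_perm {R : realType} {m : nat} (s : {perm 'I_m.+1}) :
  @dilates_at_most R _ (fun x => x *m perm_mx s) 1.
Proof.
have pE (x : 'rV[R]_m.+1) j : (x *m perm_mx s) 0 j = x 0 (s^-1%g j).
  by rewrite -[s in LHS]invgK -col_permE mxE.
apply: dilates_at_most_box_image => [l u x Bx j|l u].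
  by rewrite !pE; exact: Bx.
rewrite /box_vol [RHS](reindex_inj (@perm_inj _ s^-1%g)).
by apply: eq_bigr => j _; rewrite !pE.
Qed.

Definition rows_subst_mx {R : realType} {m : nat} (s : seq 'I_m)
    (L : 'M[R]_m) : 'M[R]_m :=
  \matrix_(i, j) if i \in s then L i j else (i == j)%:R.

(** Appending [k] to [s] amounts to multiplying on the right by the matrix that replaces row [k]
    alone. The earlier rows [i] survive because [L i k = 0]: the pairwise condition is triangularity
    in the order of [s]. *)
Lemma dilates_at_most_rows_subst {R : realType} {m : nat} (L : 'M[R]_m.+1)
    (s : seq 'I_m.+1) :
  uniq s -> pairwise (fun i k => L i k == 0) s ->
  dilates_at_most (fun x => x *m rows_subst_mx s L) (\prod_(i <- s) `|L i i|).
Proof.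
elim/last_ind: s => [_ _|s k IHs].
  rewrite big_nil; have -> : rows_subst_mx [::] L = perm_mx 1.
    by apply/matrixP => i j; rewrite !mxE perm1.
  exact: dilates_at_most_perm.
rewrite rcons_uniq pairwise_rcons => /andP[ks us] /andP[/allP Ls ps].
have -> : rows_subst_mx (rcons s k) L =
    rows_subst_mx s L *m row_subst_mx k (row k L).
  apply/row_matrixP => i; rewrite row_mul; apply/rowP => j.
  rewrite mulmx_row_subst !mxE mem_rcons inE.
  have [->|ik] /= := eqVneq i k.
    rewrite (negbTE ks) ?mul1r eq_sym.
    by case: (eqVneq k j) => _; rewrite ?mul0r ?mulr0 add0r.
  have [si|si] := boolP (i \in s).
    rewrite (eqP (Ls _ si)) mul0r addr0.
    by case: (eqVneq j k) => [->|_]; rewrite ?mul1r // (eqP (Ls _ si)) mulr0.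
  rewrite mul0r addr0.
  by case: (eqVneq j k) => [->|_]; rewrite ?mul1r // ?(negbTE ik) mulr0.
rewrite -cats1 big_cat big_seq1 /= mulrC.
rewrite (_ : (fun x => _) = (fun x => x *m row_subst_mx k (row k L)) \o
   (fun x => x *m rows_subst_mx s L)); last by apply/funext => x /=; rewrite mulmxA.
apply: dilates_at_most_comp; last exact: IHs.
by have := dilates_at_most_row_subst k (row k L); rewrite mxE.
Qed.

Lemma pairwise_enum_ord {m : nat} (r : rel 'I_m) :
  (forall i j : 'I_m, (i < j)%N -> r i j) -> pairwise r (enum 'I_m).
Proof.
move=> rlt; have : pairwise ltn (map val (enum 'I_m)).
  by rewrite val_enum_ord -sorted_pairwise ?iota_ltn_sorted //; exact: ltn_trans.
rewrite pairwise_map; exact: sub_pairwise.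
Qed.

Lemma pairwise_rev_enum_ord {m : nat} (r : rel 'I_m) :
  (forall i j : 'I_m, (j < i)%N -> r i j) -> pairwise r (rev (enum 'I_m)).
Proof.
move=> rlt; apply: (@sub_pairwise _ (fun i j : 'I_m => (j < i)%N) r _ rlt).
rewrite -sorted_pairwise; last by move=> j i k /= ji /ltn_trans; apply.
rewrite rev_sorted sorted_pairwise; last by move=> j i k /=; exact: ltn_trans.
exact: pairwise_enum_ord.
Qed.

(** In the LUP decomposition, [L] factors along increasing indices and [U] along decreasing ones.
    [L] has unit diagonal and the permutation dilates by 1, so only the diagonal of [U] counts. *)
Lemma dilates_at_most_mulmx {R : realType} {m : nat} (A : 'M[R]_m.+1) :
  dilates_at_most (fun x => x *m A) `|\det A|.
Proof.
have := cormen_lup_correct A; have := cormen_lup_perm A.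
have := cormen_lup_detL A; have := cormen_lup_lower A; have := cormen_lup_upper A.
case: cormen_lup => [[P L] U] /= Uu Ll detL /is_perm_mxP[s ->] sALU.
have all_rows M : rows_subst_mx (enum 'I_m.+1) M = M.
  by apply/matrixP => i j; rewrite mxE mem_enum.
have dL : dilates_at_most (fun x => x *m L) 1.
  have := @dilates_at_most_rows_subst _ _ L (enum 'I_m.+1) (enum_uniq _).
  rewrite all_rows big_enum /= big1 => [|i _]; last first.
    by rewrite Ll // eqxx normr1.
  apply; rewrite pairwise_enum_ord // => i j ij.
  by rewrite Ll ?(ltnW ij) // -val_eqE ltn_eqF.
have dU : dilates_at_most (fun x => x *m U) `|\det A|.
  have -> : `|\det A| = \prod_(i <- rev (enum 'I_m.+1)) `|U i i|.
    transitivity `|\det (perm_mx s * A)|.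
      by rewrite det_mulmx det_perm normrM normrX normrN1 expr1n mul1r.
    rewrite sALU det_mulmx detL mul1r -det_tr det_trig; last first.
      by apply/is_trig_mxP => i j ij; rewrite mxE Uu.
    rewrite normr_prod (perm_big _ (permEl (perm_rev _))) big_enum /=.
    by apply: eq_bigr => i _; rewrite mxE.
  have := @dilates_at_most_rows_subst _ _ U (rev (enum 'I_m.+1)).
  have -> : rows_subst_mx (rev (enum 'I_m.+1)) U = U.
    by apply/matrixP => i j; rewrite mxE mem_rev mem_enum.
  rewrite rev_uniq enum_uniq; apply => //.
  by apply: pairwise_rev_enum_ord => i j ij; rewrite Uu.
have -> : A = perm_mx s^-1%g *m L *m U.
  rewrite -mulmxA -[L *m U]/(L * U) -sALU -[_ * _]/(_ *m _) mulmxA.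
  by rewrite -perm_mxM mulVg perm_mx1 mul1mx.
rewrite (_ : (fun x => _) = (fun x => x *m U) \o ((fun x => x *m L) \o
   (fun x => x *m perm_mx s^-1%g))); last by apply/funext => x /=; rewrite !mulmxA.
have -> : \det (perm_mx s^-1%g *m L *m U) = \det U * (-1) ^+ s.
  by rewrite !det_mulmx detL mulr1 det_perm odd_permV mulrC.
rewrite normrM normrX normrN1 expr1n mulr1.
move: dU; have -> : `|\det A| = `|\det U|.
  transitivity `|\det (perm_mx s * A)|; last by rewrite sALU det_mulmx detL mul1r.
  by rewrite det_mulmx det_perm normrM normrX normrN1 expr1n mul1r.
move=> dU; rewrite -[`|\det U|]mulr1; apply: dilates_at_most_comp => //.
rewrite -[1 in X in dilates_at_most _ X]mulr1.
exact: dilates_at_most_comp dL (dilates_at_most_perm _).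
Qed.

(** * Volume of simplices *)

Lemma integral_deriv {R : realType} (p : {poly R}) (a b : R) : a < b ->
  (\int[lebesgue_measure]_(x in `[a, b]) (p^`().[x])%:E = (p.[b] - p.[a])%:E)%E.
Proof.
move=> ab; rewrite (@continuous_FTC2 _ _ (horner p)) //.
- by apply: continuous_subspaceT => x; exact: continuous_horner.
- split=> [x _||]; first exact: derivable_horner.
  + by apply: cvg_at_right_filter; exact: continuous_horner.
  + by apply: cvg_at_left_filter; exact: continuous_horner.
- by move=> x _; rewrite derivE.
Qed.

(* Induction on the dimension: integrate over the first coordinate the estimate
   obtained for the slices, which are simplices of size s - t. *)
Lemma weighted_cover_simplex {R : realType} (m : nat) (s : R) (w : nat -> R)
    (l u : nat -> 'I_m -> R) :
  0 <= s -> (forall k, 0 <= w k) -> (forall k j, l k j <= u k j) ->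
  (forall x : 'I_m -> R, (forall j, 0 <= x j) -> \sum_j x j <= s ->
     (1 <= \sum_(0 <= k <oo)
             (w k * \prod_j (l k j <= x j <= u k j)%R%:R)%:E)%E) ->
  ((s ^+ m / m`!%:R)%:E <=
     \sum_(0 <= k <oo) (w k * \prod_j (u k j - l k j))%:E)%E.
Proof.
elim: m s w l u => [|m IHm] s w l u s0 w0 lu cover.
  rewrite expr0 divr1.
  have := cover (fun=> 0); rewrite big_ord0 => /(_ _ s0).
  under eq_eseriesr do rewrite big_ord0.
  by under [X in _ -> (_ <= X)%E]eq_eseriesr do rewrite big_ord0; apply.
pose V k := \prod_j (u k (lift ord0 j) - l k (lift ord0 j)).
have V0 k : 0 <= V k by apply: prodr_ge0 => j _; rewrite subr_ge0.
have [s_gt0|s_le0] := ltP 0 s; last first.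
  have -> : s = 0 by apply/le_anti; rewrite s_le0.
  rewrite expr0n mul0r; apply: nneseries_ge0 => k _ _.
  by rewrite lee_fin mulr_ge0 // prodr_ge0 // => j _; rewrite subr_ge0.
pose I k : set R := `[l k ord0, u k ord0]%classic.
pose f k (t : R) : \bar R := ((w k * V k) * \1_(I k) t)%:E.
have f0 k t : (0 <= f k t)%E by rewrite lee_fin !mulr_ge0.
have mf k D : measurable_fun D (f k).
  apply/measurable_EFinP; apply: measurable_funM => //.
  by apply: measurable_indic; exact: measurable_itv.
(* An antiderivative of [(s - t) ^+ m / m!], the bound for the slice at [t]; it increases by
   [s ^+ m.+1 / (m.+1)!] from 0 to [s]. *)
pose p : {poly R} := (- (m.+1)`!%:R^-1) *: ((s%:P - 'X) ^+ m.+1).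
have dp t : p^`().[t] = (s - t) ^+ m / m`!%:R.
  rewrite derivZ deriv_exp derivB derivC derivX sub0r mulN1r hornerZ.
  rewrite hornerMn hornerN horner_exp !hornerE factS natrM.
  have fm0 : m`!%:R != 0 :> R by rewrite pnatr_eq0 -lt0n fact_gt0.
  have m0 : m.+1%:R != 0 :> R by rewrite pnatr_eq0.
  rewrite -mulr_natr.
  by field; rewrite fm0 nat1r.
(* The new weights [w k * \1_(I k) t] discard the boxes that miss the slice at [t]; the induction
   carries weights for this purpose. *)
have slice t : t \in `[0, s] -> ((p^`().[t])%:E <= \sum_(0 <= k <oo) f k t)%E.
  rewrite in_itv /= => /andP[t0 ts]; rewrite dp.
  have := IHm (s - t) (fun k => w k * \1_(I k) t)
    (fun k j => l k (lift ord0 j)) (fun k j => u k (lift ord0 j)).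
  under [X in _ -> _ -> _ -> _ -> (_ <= X)%E]eq_eseriesr do
    rewrite mulrAC -/(V _).
  apply => //.
  - by rewrite subr_ge0.
  - by move=> k; rewrite mulr_ge0.
  move=> y y0 ys.
  pose x i := if unlift ord0 i is Some j then y j else t.
  have x0 : x ord0 = t by rewrite /x unlift_none.
  have xS j : x (lift ord0 j) = y j by rewrite /x liftK.
  apply: le_trans (cover x _ _) _.
  - by move=> i; rewrite /x; case: unliftP.
  - by rewrite big_ord_recl x0 -lerBrDl (eq_bigr y) // => j _; exact: xS.
  apply: lee_nneseries => k *; first by rewrite lee_fin mulr_ge0 // prodr_ge0.
  rewrite big_ord_recl x0 mulrA lee_fin (_ : \1_(I k) t = (l k ord0 <= t <= u k ord0)%R%:R).
    suff -> : \prod_j (l k (lift ord0 j) <= x (lift ord0 j) <= u k (lift ord0 j))%R%:R =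
      \prod_j (l k (lift ord0 j) <= y j <= u k (lift ord0 j))%R%:R :> R by [].
    by apply: eq_bigr => j _; rewrite xS.
  by rewrite indicE /I mem_setE /= in_itv.
have -> : ((s ^+ m.+1 / (m.+1)`!%:R)%:E =
    \int[lebesgue_measure]_(t in `[0%R, s]) (p^`().[t])%:E)%E.
  rewrite integral_deriv // !hornerZ !horner_exp !hornerE subrr expr0n /= mulr0.
  by rewrite sub0r mulNr opprK mulrC subr0.
apply: (@le_trans _ _ (\int[lebesgue_measure]_(t in `[0%R, s])
    \sum_(0 <= k <oo) f k t)%E).
  apply: ge0_le_integral => //.
  - move=> t; rewrite /= in_itv /= => /andP[_ ts].
    by rewrite dp lee_fin divr_ge0 // exprn_ge0 // subr_ge0.
  - apply/measurable_EFinP; apply: measurable_funTS; apply: continuous_measurable_fun.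
    exact: continuous_horner.
  - by apply: ge0_emeasurable_sum => // k _; exact: mf.
rewrite (@integral_nneseries _ _ R (@lebesgue_measure R) `[0, s]%classic _ f) //; last first.
  by move=> k; exact: mf.
apply: lee_nneseries => [k _ _|k _]; first exact: integral_ge0.
under eq_integral do rewrite /f EFinM.
rewrite ge0_integralZl //; last 2 first.
- by apply/measurable_EFinP/measurable_indic; exact: measurable_itv.
- by rewrite lee_fin mulr_ge0.
have mI : measurable (I k) by exact: measurable_itv.
rewrite integral_indic //.
apply: (@le_trans _ _ ((w k * V k)%:E * lebesgue_measure (I k))%E).
  apply: lee_wpmul2l; first by rewrite lee_fin mulr_ge0.
  apply: le_measure => //; apply/mem_set => //.
  exact: measurableI.
rewrite lebesgue_measure_itv /= lte_fin big_ord_recl -/(V k).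
case: ltP => [_|ul]; first by rewrite -EFinB -EFinM lee_fin mulrAC mulrA.
by rewrite mule0 lee_fin !mulr_ge0 // subr_ge0.
Qed.

Definition std_simplex (R : realType) (m : nat) : set 'rV[R]_m :=
  [set x | (forall j, 0 <= x 0 j) /\ \sum_j x 0 j <= 1].

(** The weighted estimate with [s = 1] and unit weights: a box containing a point contributes a term
    1 to the sum at that point. *)
Lemma lebesgue_outer_std_simplex_ge {R : realType} (m : nat) :
  ((m`!%:R^-1)%:E <= lebesgue_outer (std_simplex R m))%E.
Proof.
apply: le_ereal_inf_tmp => _ [l [u [lu cover ->]]].
have := @weighted_cover_simplex R m 1 (fun=> 1) (fun k => l k 0) (fun k => u k 0).
rewrite expr1n mul1r; under eq_eseriesr do rewrite mul1r; apply => // x x0 xs.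
have [|k _ Bk] := cover (\row_j x j).
  by split=> [j|]; [rewrite mxE|under eq_bigr do rewrite mxE].
apply: le_trans (nneseries_lim_ge k.+1 _); last first.
  by move=> i _ _; rewrite lee_fin mul1r prodr_ge0.
have kE : \prod_j (l k 0 j <= x j <= u k 0 j)%R%:R = 1 :> R.
  by rewrite big1 // => j _; have := Bk j; rewrite mxE => ->.
rewrite big_nat_recr //= kE mulr1.
by rewrite leeDr // sume_ge0 // => i _; rewrite lee_fin mul1r prodr_ge0.
Qed.

Lemma ffact_le_expn (n m : nat) : (n ^_ m <= n ^ m)%N.
Proof.
elim: m n => [|m IHm] n; first by rewrite ffactn0.
rewrite ffactnS expnS leq_mul2l (leq_trans (IHm _)) ?orbT //.
by case: m {IHm} => // m; rewrite leq_exp2r // leq_pred.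
Qed.

(* Cover by the cubes of side 1/K whose lowest corner t/K has sum t <= K. *)
Lemma lebesgue_outer_std_simplex_le {R : realType} (m : nat) :
  (lebesgue_outer (std_simplex R m.+1) <= ((m.+1)`!%:R^-1)%:E)%E.
Proof.
set M := m.+1.
(* There are ['C(M + K, M)] cubes, at most [(M + K) ^ M / M!], each of volume [1 / K ^ M]; the
   product of these two bounds is the value of [p] at [1 / K]. *)
pose p : {poly R} := M`!%:R^-1 *: (1 + M%:R *: 'X) ^+ M.
have p0 : p.[0] = M`!%:R^-1 by rewrite !hornerE expr1n mulr1.
set v := lebesgue_outer _.
suff vp N : (v <= (p.[N.+1%:R^-1])%:E)%E.
  have : v \is a fin_num.
    by rewrite ge0_fin_numE ?lebesgue_outer_ge0 // (le_lt_trans (vp 0%N)) ?ltry.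
  move/fineK => vE; rewrite -p0 -vE lee_fin; apply: ler_horner0 => N.
  by rewrite -lee_fin vE.
pose K := N.+1; have K0 : 0 < K%:R :> R by rewrite ltr0n.
pose T := [set t : M.-tuple 'I_K.+1 | (\sum_(i <- t) i <= K)%N]%SET.
pose l (t : {t | t \in T}) : 'rV[R]_M := \row_j ((tnth (val t) j : nat)%:R / K%:R).
pose u (t : {t | t \in T}) : 'rV[R]_M := \row_j ((tnth (val t) j : nat).+1%:R / K%:R).
apply: le_trans (lebesgue_outer_le_sum _ l u _ _) _.
- by move=> t j; rewrite !mxE ler_pM2r ?invr_gt0 // ler_nat.
- move=> x [x0 xs].
  have Kx0 j : 0 <= K%:R * x 0 j by rewrite mulr_ge0.
  (* [inord] does not fall back on its default value, since [x_j <= 1] makes the integer part at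
     most [K]. *)
  have tE j : ((inord (Num.truncn (K%:R * x 0 j)) : 'I_K.+1) : nat) =
      Num.truncn (K%:R * x 0 j).
    rewrite inordK // ltnS -(ler_nat R) (@le_trans _ _ (K%:R * x 0 j)) ?truncn_le //.
    rewrite ler_piMr ?ler0n // (le_trans _ xs) // (bigD1 j) //= lerDl.
    exact: sumr_ge0.
  pose t := [tuple (inord (Num.truncn (K%:R * x 0 j)) : 'I_K.+1) | j < M].
  have tT : t \in T.
    rewrite inE -(ler_nat R) big_tuple natr_sum (@le_trans _ _ (\sum_j K%:R * x 0 j)) //.
      by apply: ler_sum => j _; rewrite tnth_mktuple tE truncn_le.
    by rewrite -mulr_sumr ler_piMr.
  exists (exist _ t tT) => j; rewrite !mxE /= tnth_mktuple tE.
  rewrite ler_pdivrMr // ler_pdivlMr // ![x 0 j * _]mulrC truncn_le Kx0 /=.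
  exact/ltW/truncnS_gt.
rewrite lee_fin (eq_bigr (fun=> K%:R ^- M)); last first.
  move=> t _; rewrite /box_vol (eq_bigr (fun=> K%:R^-1)).
    by rewrite prodr_const card_ord exprVn.
  move=> j _.
  by rewrite !mxE -mulrBl -natrB // subSnn mul1r.
rewrite sumr_const card_sig /= (eq_card (_ : _ =i T)) // card_partial_ord_partitions.
rewrite /p !hornerE -/K -[leLHS]mulr_natl ler_pdivrMr ?exprn_gt0 //.
rewrite -mulrA -exprMn mulrDl mul1r divfK ?gt_eqF // [leRHS]mulrC.
rewrite ler_pdivlMr ?ltr0n ?fact_gt0 //.
by rewrite -natrM bin_ffact addrC -natrD -natrX ler_nat ffact_le_expn.
Qed.

Lemma lebesgue_outer_std_simplex {R : realType} (m : nat) :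
  lebesgue_outer (std_simplex R m.+1) = ((m.+1)`!%:R^-1)%:E.
Proof.
apply: le_anti; rewrite lebesgue_outer_std_simplex_le.
exact: lebesgue_outer_std_simplex_ge.
Qed.

Lemma dilates_at_most_affine {R : realType} {m : nat} (v : 'rV[R]_m.+1)
    (Y : 'M[R]_m.+1) :
  dilates_at_most (fun x => v + x *m Y) `|\det Y|.
Proof.
rewrite -[`|_|]mul1r.
exact: (dilates_at_most_comp _ _ _ _ (dilates_at_most_translate v)
  (dilates_at_most_mulmx Y)).
Qed.

Lemma lebesgue_outer_affine {R : realType} {m : nat} (v : 'rV[R]_m.+1)
    (Y : 'M[R]_m.+1) (E : set 'rV[R]_m.+1) (r : R) : Y \in unitmx ->
  lebesgue_outer E = r%:E ->
  lebesgue_outer ((fun x => v + x *m Y) @` E) = (`|\det Y| * r)%:E.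
Proof.
move=> Yu Er; set F := _ @` E.
have invE x : - v *m invmx Y + (v + x *m Y) *m invmx Y = x.
  by rewrite -mulmxDl addKr mulmxK.
have FE : E = (fun x => - v *m invmx Y + x *m invmx Y) @` F.
  apply/seteqP; split=> [x Ex|_ [_ [x Ex <-] <-]]; last by rewrite invE.
  by exists (v + x *m Y); [exists x|exact: invE].
have Fle : (lebesgue_outer F <= (`|\det Y| * r)%:E)%E.
  by apply: dilates_at_most_affine; rewrite Er.
have Ffin : lebesgue_outer F \is a fin_num.
  by rewrite ge0_fin_numE ?lebesgue_outer_ge0 // (le_lt_trans Fle) ?ltry.
move: Fle; rewrite -(fineK Ffin) lee_fin => Fle; congr (_%:E).
apply: le_anti; rewrite Fle /=.
have := dilates_at_most_affine (- v *m invmx Y) (invmx Y) F (fine (lebesgue_outer F)).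
rewrite -FE Er fineK // lexx lee_fin det_inv normfV => /(_ isT).
by rewrite mulrC ler_pdivlMr ?normr_gt0 -?unitfE -?unitmxE // mulrC.
Qed.

Definition edge_mx {R : realType} {n m : nat} (y : 'I_m.+1 -> 'rV[R]_n) :
    'M[R]_(m, n) :=
  \matrix_(j < m) (y (lift ord0 j) - y ord0).

Lemma sum_vertices {R : realType} {n m : nat} (y : 'I_m.+1 -> 'rV[R]_n)
    (c : 'I_m.+1 -> R) : \sum_i c i = 1 ->
  \sum_i c i *: y i = y ord0 + (\row_j c (lift ord0 j)) *m edge_mx y.
Proof.
rewrite big_ord_recl => c1; rewrite mulmx_sum_row big_ord_recl.
have -> : c ord0 = 1 - \sum_j c (lift ord0 j) by rewrite -c1 addrK.
rewrite scalerBl scale1r scaler_suml -addrA; congr (_ + _).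
rewrite addrC -sumrB; apply: eq_bigr => j _.
by rewrite mxE rowK scalerBr.
Qed.

Lemma simplex_std {R : realType} {n m : nat} (y : 'I_m.+1 -> 'rV[R]_n) :
  simplex y = (fun x => y ord0 + x *m edge_mx y) @` std_simplex R m.
Proof.
apply/seteqP; split=> [_ [c [c0 c1 ->]]|_ [x [x0 x1] <-]].
  exists (\row_j c (lift ord0 j)); last by rewrite sum_vertices.
  split=> [j|]; first by rewrite mxE.
  under eq_bigr do rewrite mxE.
  by rewrite -c1 [leRHS]big_ord_recl lerDr.
pose c i := if unlift ord0 i is Some j then x 0 j else 1 - \sum_j x 0 j.
have cS j : c (lift ord0 j) = x 0 j by rewrite /c liftK.
have c1 : \sum_i c i = 1.
  rewrite big_ord_recl (eq_bigr (x 0)) => [|j _]; last exact: cS.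
  by rewrite /c unlift_none subrK.
exists c; split=> // [i|].
  by rewrite /c; case: unliftP => [j _|_] //; rewrite subr_ge0.
rewrite sum_vertices //; congr (_ + _ *m _).
by apply/rowP => j; rewrite mxE cS.
Qed.

Lemma lebesgue_outer_simplex {R : realType} {m : nat}
    (y : 'I_m.+2 -> 'rV[R]_m.+1) : edge_mx y \in unitmx ->
  lebesgue_outer (simplex y) = (`|\det (edge_mx y)| / (m.+1)`!%:R)%:E.
Proof.
move=> yu; rewrite simplex_std.
exact: lebesgue_outer_affine yu (lebesgue_outer_std_simplex m).
Qed.

Lemma vertex_simplex {R : realType} {n m : nat} (y : 'I_m -> 'rV[R]_n) (i : 'I_m) :
  simplex y (y i).
Proof.
exists (fun j => (j == i)%:R); split=> [j||]; first exact: ler0n.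
  by rewrite (bigD1 i) //= eqxx big1 ?addr0 // => j /negbTE ->.
rewrite (bigD1 i) //= eqxx scale1r big1 ?addr0 // => j /negbTE ->.
by rewrite scale0r.
Qed.

(** In the isometric chart the edge matrix becomes a square [Y] with [edge_mx B = Y *m Q]; as the
    rows of [Q] are orthonormal, the Gram determinant is the square of [\det Y]. The right inverse
    [H] expresses that the edges are independent and makes [Y] invertible. *)
Lemma sqr_volume_simplex {R : realType} {n m : nat} (B : 'I_m.+2 -> 'rV[R]_n)
    (H : 'M[R]_(n, m.+1)) (a : R) : edge_mx B *m H = 1%:M ->
  has_volume m.+1 (simplex B) a ->
  a ^+ 2 = \det (edge_mx B *m (edge_mx B)^T) / (m.+1)`!%:R ^+ 2.
Proof.
move=> EH [p [Q [QQ BQ vol]]].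
pose f (y : 'rV[R]_m.+1) := p + y *m Q.
have [y By] : {y & forall i, B i = f (y i)}.
  apply: (@choice _ _ (fun i y => B i = f y)) => i.
  by have [y _ <-] := BQ _ (vertex_simplex B i); exists y.
have f_inj : injective f.
  move=> x x' /addrI /(congr1 (fun z => z *m Q^T)).
  by rewrite -!mulmxA QQ !mulmx1.
have f_sum (c : 'I_m.+2 -> R) : \sum_i c i = 1 ->
    f (\sum_i c i *: y i) = \sum_i c i *: B i.
  move=> c1; under [RHS]eq_bigr do rewrite By scalerDr.
  rewrite big_split /= -scaler_suml c1 scale1r; congr (_ + _).
  by rewrite mulmx_suml; apply: eq_bigr => i _; rewrite scalemxAl.
have preB : f @^-1` simplex B = simplex y.
  apply/seteqP; split=> [x [c [c0 c1 fx]]|_ [c [c0 c1 ->]]].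
    by exists c; split => //; apply: f_inj; rewrite fx f_sum.
  by exists c; split => //; rewrite f_sum.
have YQ : edge_mx B = edge_mx y *m Q.
  apply/row_matrixP => j; rewrite row_mul !rowK !By /f mulmxBl.
  by rewrite opprD addrACA subrr add0r.
have Yu : edge_mx y \in unitmx.
  by have /mulmx1_unit[] : edge_mx y *m (Q *m H) = 1%:M by rewrite mulmxA -YQ.
move: vol; rewrite preB lebesgue_outer_simplex // => -[<-].
rewrite expr_div_n real_normK ?num_real //; congr (_ / _).
by rewrite YQ trmx_mul mulmxA -(mulmxA _ Q) QQ mulmx1 det_mulmx det_tr.
Qed.

(** * Integral multiples of algebraic numbers *)

(** Clearing denominators gives an integer polynomial [q] killing [x]; its leading coefficient is
    the multiplier [c]. *)
Lemma exists_integral_multiple {R : realType} (x : R) :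
  algebraicOver (ratr : rat -> R) x ->
  exists2 c : int, c != 0 & integralOver (intmul 1 : int -> R) (c%:~R * x).
Proof.
move=> [p p0 px]; have [q [a a0 pE]] := rat_poly_scale p.
have q0 : q != 0.
  by apply: contraNneq p0 => q0; rewrite pE q0 map_poly0 scaler0.
have qx : (map_poly (intmul 1 : int -> R) q).[x] = 0.
  move: px; rewrite pE map_polyZ -map_poly_comp rootZ ?fmorph_eq0; last first.
    by rewrite invr_eq0 intr_eq0.
  move=> /rootP; rewrite (eq_map_poly (g := intmul 1)) // => z /=.
  exact: ratr_int.
have q_gt1 : (1 < size q)%N.
  rewrite ltnNge; apply/negP => /size1_polyC qc.
  move: qx; rewrite qc map_polyC hornerC => /eqP; rewrite intr_eq0 => /eqP c0.
  by move: q0; rewrite qc c0 polyC0 eqxx.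
pose n := (size q).-2; have nE : size q = n.+2 by rewrite /n; case: size q_gt1 => [|[]].
pose c := lead_coef q; have c0 : c != 0 by rewrite lead_coef_eq0.
have cE : q`_n.+1 = c by rewrite /c /lead_coef nE.
exists c => //.
(* This is [c ^+ n * q(X / c)], monic and integral because [q] has degree [n.+1]. *)
pose r : {poly int} := 'X^(n.+1) + \poly_(i < n.+1) (q`_i * c ^+ (n - i)).
exists r.
  by rewrite monicE lead_coefDl ?lead_coefXn // size_polyXn ltnS size_poly.
(* The extra factor [c] turns the claim into [c * r(c * x) = c ^+ n.+1 * q(x)], free of negative
   powers of [c]. *)
apply/rootP; apply: (mulfI (_ : c%:~R != 0 :> R)); first by rewrite intr_eq0.
rewrite mulr0 /r rmorphD /= map_polyXn hornerD hornerXn.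
have := congr1 (fun z => c%:~R ^+ n.+1 * z) qx; rewrite mulr0 => <-.
rewrite (@horner_coef_wide _ n.+2 _ x); last first.
  by rewrite (size_map_inj_poly intr_inj) ?nE.
rewrite (@horner_coef_wide _ n.+1); last first.
  by rewrite (size_map_inj_poly intr_inj) ?size_poly.
rewrite [X in _ = _ * X]big_ord_recr /= coef_map cE !mulrDr [RHS]addrC; congr (_ + _).
  by rewrite exprMn; ring.
rewrite !mulr_sumr; apply: eq_bigr => i _.
rewrite !coef_map coef_poly ltn_ord /= rmorphM rmorphXn /= exprMn.
have -> : c%:~R ^+ n.+1 = c%:~R * c%:~R ^+ (n - i) * c%:~R ^+ i :> R.
  by rewrite -exprS -exprD addSn subnK // -ltnS.
by ring.
Qed.

(** * Barycentric coordinates *)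

(** With [N = (g | H)] and [M'] obtained from [M] by replacing [d] with [g^T], the products [M N],
    [M' N] and [M M'^T] are block triangular, of determinants 1, [g^T g] and [\det (E E^T)].
    Eliminating [N] and [M'] gives the formula. *)
Lemma det_gram {R : comUnitRingType} {p : nat} (d : 'rV[R]_p.+1)
    (E : 'M[R]_(p, p.+1)) (g : 'cV[R]_p.+1) (H : 'M[R]_(p.+1, p)) :
  d *m g = 1%:M -> E *m g = 0 -> E *m H = 1%:M ->
  let M : 'M[R]_p.+1 := col_mx d E in
  M \in unitmx /\ \det (E *m E^T) = \det M ^+ 2 * (g^T *m g) 0 0.
Proof.
move=> dg Eg EH M; pose N : 'M[R]_p.+1 := row_mx g H.
pose M' : 'M[R]_p.+1 := col_mx g^T E.
have MN : \det M * \det N = 1.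
  rewrite -det_mulmx /M /N (@mul_col_row _ 1 p p.+1 1 p) dg Eg EH.
  by rewrite (@det_ublock _ 1 p) !det1 mulr1.
have M'N : \det M' * \det N = (g^T *m g) 0 0.
  rewrite -det_mulmx /M' /N (@mul_col_row _ 1 p p.+1 1 p) Eg EH.
  by rewrite (@det_ublock _ 1 p) det1 mulr1 det_mx11.
have MM' : \det M * \det M' = \det (E *m E^T).
  rewrite -(det_tr M') -det_mulmx /M /M' (@tr_col_mx _ 1 p) trmxK.
  rewrite (@mul_col_row _ 1 p p.+1 1 p) dg Eg.
  by rewrite (@det_ublock _ 1 p) det1 mul1r.
have Mu : M \in unitmx by rewrite unitmxE; apply/unitrPr; exists (\det N).
split=> //; rewrite -MM' -M'N expr2 -mulrA; congr (_ * _).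
by rewrite mulrCA MN mulr1.
Qed.

(** The vertices in homogeneous coordinates, so that the sum of the weights and the weighted sum of
    the vertices come from one product. *)
Definition aug_mx {R : realType} {n : nat} (A : 'I_n.+1 -> 'rV[R]_n) :
    'M[R]_n.+1 :=
  \matrix_(i < n.+1) row_mx (1%:M : 'M[R]_1) (A i).

Definition bary {R : realType} {n : nat} (A : 'I_n.+1 -> 'rV[R]_n)
    (x : 'rV[R]_n) : 'rV[R]_n.+1 :=
  row_mx (1%:M : 'M[R]_1) x *m invmx (aug_mx A).

(** The top row of the inverse holds the constant terms of the barycentric coordinates; column [i]
    of the rest is the gradient of the [i]-th one. *)
Definition bary_grad {R : realType} {n : nat} (A : 'I_n.+1 -> 'rV[R]_n) :
    'M[R]_(n, n.+1) :=
  dsubmx (invmx (aug_mx A) : 'M[R]_(1 + n, n.+1)).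

Lemma mul_aug_mx {R : realType} {n : nat} (A : 'I_n.+1 -> 'rV[R]_n)
    (c : 'rV[R]_n.+1) :
  c *m aug_mx A = row_mx (\sum_i c 0 i)%:M (\sum_i c 0 i *: A i).
Proof.
apply/rowP => j; rewrite mxE; case: (@split_ordP 1 n j) => k ->.
  rewrite (@row_mxEl _ 1 1 n) mxE -sumrMnl; apply: eq_bigr => i _.
  by rewrite mxE (@row_mxEl _ 1 1 n) mxE mulrnAr mulr1.
rewrite (@row_mxEr _ 1 1 n) summxE; apply: eq_bigr => i _.
by rewrite mxE (@row_mxEr _ 1 1 n) mxE.
Qed.

Lemma aug_mx_unit {R : realType} {n : nat} (A : 'I_n.+1 -> 'rV[R]_n) :
  affinely_independent A -> aug_mx A \in unitmx.
Proof.
move=> hA; rewrite -row_free_unit; apply: inj_row_free => v.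
rewrite mul_aug_mx => vB.
have [v1 vA] := @eq_row_mx _ 1 1 n _ _ 0 0 (etrans vB (esym (@row_mx0 R 1 1 n))).
have v1' : \sum_i v 0 i = 0.
  by move/matrixP: v1 => /(_ 0 0); rewrite !mxE mulr1n.
apply/rowP => i; rewrite [RHS]mxE; exact: (hA (fun i => v 0 i) v1' vA i).
Qed.

Lemma bary_sum {R : realType} {n : nat} (A : 'I_n.+1 -> 'rV[R]_n)
    (c : 'I_n.+1 -> R) : affinely_independent A -> \sum_i c i = 1 ->
  bary A (\sum_i c i *: A i) = \row_i c i.
Proof.
move=> /aug_mx_unit Au c1; apply: (can_inj (mulmxK Au)).
rewrite /bary mulmxKV // mul_aug_mx.
have -> : \sum_i (\row_i c i) 0 i = 1 by under eq_bigr do rewrite mxE.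
by under [in RHS]eq_bigr do rewrite mxE.
Qed.

Lemma baryK {R : realType} {n : nat} (A : 'I_n.+1 -> 'rV[R]_n) (x : 'rV[R]_n) :
  affinely_independent A ->
  \sum_i bary A x 0 i = 1 /\ \sum_i bary A x 0 i *: A i = x.
Proof.
move=> /aug_mx_unit Au; have := mul_aug_mx A (bary A x).
rewrite /bary mulmxKV // => e.
have [/matrixP/(_ 0 0) e1 e2] := @eq_row_mx _ 1 1 n _ _ _ _ e.
by split; [move: e1; rewrite !mxE !mulr1n => <-|].
Qed.

Lemma baryB {R : realType} {n : nat} (A : 'I_n.+1 -> 'rV[R]_n) (x y : 'rV[R]_n) :
  bary A y - bary A x = (y - x) *m bary_grad A.
Proof.
rewrite /bary -mulmxBl (@opp_row_mx _ 1 1 n) (@add_row_mx _ 1 1 n) subrr.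
rewrite -[invmx _ in LHS](@vsubmxK _ 1 n) (@mul_row_col _ 1 1 n) mul0mx add0r.
by [].
Qed.

Lemma bary_vertex {R : realType} {n : nat} (A : 'I_n.+1 -> 'rV[R]_n)
    (j : 'I_n.+1) : affinely_independent A -> bary A (A j) = delta_mx 0 j.
Proof.
move=> hA.
have c1 : \sum_i (i == j)%:R = 1 :> R.
  by rewrite (bigD1 j) //= eqxx big1 ?addr0 // => i /negbTE ->.
have -> : A j = \sum_i (i == j)%:R *: A i.
  rewrite (bigD1 j) //= eqxx scale1r big1 ?addr0 // => i /negbTE ->.
  by rewrite scale0r.
by rewrite bary_sum //; apply/rowP => i; rewrite !mxE eqxx.
Qed.

Lemma simplexP {R : realType} {n : nat} (A : 'I_n.+1 -> 'rV[R]_n) (x : 'rV[R]_n) :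
  affinely_independent A ->
  simplex A x <-> forall i, 0 <= bary A x 0 i.
Proof.
move=> hA; split=> [[c [c0 c1 ->]] i|x0]; first by rewrite bary_sum // mxE.
by have [b1 bx] := baryK A x hA; exists (fun i => bary A x 0 i).
Qed.

Lemma facetP {R : realType} {n : nat} (A : 'I_n.+1 -> 'rV[R]_n) (i : 'I_n.+1)
    (x : 'rV[R]_n) : affinely_independent A ->
  facet A i x <-> (forall j, 0 <= bary A x 0 j) /\ bary A x 0 i = 0.
Proof.
move=> hA; split=> [[c [c0 c1 ->]]|[x0 xi]].
  pose c' j := if unlift i j is Some j' then c j' else 0.
  have c'i : c' i = 0 by rewrite /c' unlift_none.
  have c'S j : c' (lift i j) = c j by rewrite /c' liftK.
  have -> : \sum_j c j *: A (lift i j) = \sum_j c' j *: A j.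
    rewrite (bigD1_ord i) //= c'i scale0r add0r.
    by apply: eq_bigr => j _; rewrite c'S.
  have c'1 : \sum_j c' j = 1.
    by rewrite (bigD1_ord i) //= c'i add0r -c1; apply: eq_bigr => j _; rewrite c'S.
  rewrite bary_sum //; split=> [j|]; rewrite mxE //.
  by rewrite /c'; case: unliftP.
have [b1 bx] := baryK A x hA; exists (fun j => bary A x 0 (lift i j)); split => //.
  by rewrite -b1 [RHS](bigD1_ord i) //= xi add0r.
by rewrite -{1}bx (bigD1_ord i) //= xi scale0r add0r.
Qed.

(** * The incenter *)

Lemma enorm_ge0 {R : realType} {n : nat} (x : 'rV[R]_n) : 0 <= enorm x.
Proof. exact: sqrtr_ge0. Qed.

Lemma sqr_enorm {R : realType} {n : nat} (x : 'rV[R]_n) :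
  enorm x ^+ 2 = \sum_j x 0 j ^+ 2.
Proof. by rewrite sqr_sqrtr // sumr_ge0 // => j _; exact: sqr_ge0. Qed.

Lemma enorm_eq {R : realType} {n : nat} (x : 'rV[R]_n) (r : R) : 0 <= r ->
  \sum_j x 0 j ^+ 2 = r ^+ 2 -> enorm x = r.
Proof. by move=> r0; rewrite /enorm => ->; rewrite sqrtr_sqr ger0_norm. Qed.

Lemma enorm_gt0 {R : realType} {n : nat} (x : 'rV[R]_n) : x != 0 -> 0 < enorm x.
Proof.
move=> x0; rewrite lt_def enorm_ge0 andbT; apply: contraNneq x0 => ex0.
have := sqr_enorm x; rewrite ex0 expr0n /= => /esym/eqP.
rewrite psumr_eq0 => [/allP x0|j _]; last exact: sqr_ge0.
by apply/eqP/rowP => j; have := x0 j (mem_index_enum _); rewrite sqrf_eq0 mxE => /eqP.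
Qed.

(* Cauchy-Schwarz with its equality case, from the expansion of the squared
   norm of |g| v + |v| g *)
Lemma enorm_dot {R : realType} {n : nat} (v g : 'rV[R]_n) (r : R) :
  enorm v = r -> g != 0 ->
  let d := \sum_j v 0 j * g 0 j in
  - (r * enorm g) <= d /\ (0 < r -> d = - (r * enorm g) -> v = - (r / enorm g) *: g).
Proof.
move=> vr /enorm_gt0 g0 d; set c := enorm g in g0 *.
have sq : \sum_j (c * v 0 j + r * g 0 j) ^+ 2 = 2 * r * c * (r * c + d).
  transitivity (c ^+ 2 * (\sum_j v 0 j ^+ 2) + (2 * r * c) * d +
                r ^+ 2 * (\sum_j g 0 j ^+ 2)).
    rewrite /d !mulr_sumr -!big_split /=.
    by apply: eq_bigr => j _; ring.
  by rewrite -!sqr_enorm vr -/c; ring.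
have sq0 : 0 <= 2 * r * c * (r * c + d).
  by rewrite -sq sumr_ge0 // => j _; exact: sqr_ge0.
have r0 : 0 <= r by rewrite -vr enorm_ge0.
split=> [|r_gt0 dE].
  have [r_gt0|] := ltP 0 r.
    by rewrite -subr_ge0 opprK addrC -(pmulr_rge0 _ (_ : 0 < 2 * r * c)) // !mulr_gt0.
  move=> r_le0; have r00 : r = 0 by apply/le_anti; rewrite r_le0.
  have v0 : v = 0.
    apply/eqP; apply: contraT => /enorm_gt0; by rewrite vr r00 ltxx.
  by rewrite r00 mul0r oppr0 /d v0 big1 // => j _; rewrite mxE mul0r.
move: sq; rewrite dE subrr mulr0 => /eqP.
rewrite psumr_eq0 => [/allP all0|j _]; last exact: sqr_ge0.
apply/rowP => j; have := all0 j (mem_index_enum _); rewrite sqrf_eq0 mxE => /eqP cj.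
apply: (mulfI (lt0r_neq0 g0)); rewrite mulrA mulrN mulrCA divff ?gt_eqF // mulr1.
by apply/eqP; rewrite mulNr -subr_eq0 opprK cj.
Qed.

Definition normal {R : realType} {n : nat} (A : 'I_n.+1 -> 'rV[R]_n)
    (i : 'I_n.+1) : 'rV[R]_n := (col i (bary_grad A))^T.

Lemma bary_normal {R : realType} {n : nat} (A : 'I_n.+1 -> 'rV[R]_n)
    (x y : 'rV[R]_n) (i : 'I_n.+1) :
  bary A y 0 i = bary A x 0 i + \sum_j (y - x) 0 j * normal A i 0 j.
Proof.
have /(congr1 (fun z : 'rV_n.+1 => z 0 i)) := baryB A x y.
rewrite !mxE => /eqP; rewrite subr_eq => /eqP ->; rewrite addrC; congr (_ + _).
by apply: eq_bigr => j _; rewrite !mxE.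
Qed.

(** The [i]-th coordinate passes from 0 at another vertex to 1 at [A i], hence is not constant. *)
Lemma normal_neq0 {R : realType} {n : nat} (A : 'I_n.+2 -> 'rV[R]_n.+1)
    (i : 'I_n.+2) : affinely_independent A -> normal A i != 0.
Proof.
move=> hA; apply/eqP => Ni.
have := bary_normal A (A (lift i ord0)) (A i) i; rewrite Ni !bary_vertex // !mxE !eqxx.
rewrite (negbTE (neq_lift i ord0)) big1 => [|j _]; last by rewrite [X in _ * X]mxE mulr0.
by move/eqP; rewrite addr0 oner_eq0.
Qed.

(** On the sphere the [i]-th coordinate has minimum [bary A c 0 i - r * enorm (normal A i)],
    attained only at [p r i] by the equality case of Cauchy-Schwarz. Inclusion in the simplex makes
    the minima nonnegative, contact with the facets makes them nonpositive. Conversely, if they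
    vanish, [p r i] is the single contact point. *)
Lemma is_incenterP {R : realType} {n : nat} (A : 'I_n.+2 -> 'rV[R]_n.+1)
    (c : 'rV[R]_n.+1) : affinely_independent A ->
  is_incenter A c <->
  exists2 r, 0 < r & forall i, bary A c 0 i = r * enorm (normal A i).
Proof.
move=> hA; have N0 i := normal_neq0 A i hA.
have Ngt0 i := enorm_gt0 _ (N0 i).
pose p r i := c - (r / enorm (normal A i)) *: normal A i.
have p_sphere r i : 0 < r -> esphere c r (p r i).
  move=> r0; apply: enorm_eq; first exact: ltW.
  rewrite /p [c - _]addrC addrK.
  transitivity ((r / enorm (normal A i)) ^+ 2 * enorm (normal A i) ^+ 2).
    rewrite sqr_enorm mulr_sumr; apply: eq_bigr => j _.
    by rewrite !mxE sqrrN exprMn.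
  by rewrite -exprMn divfK ?gt_eqF.
have bary_p r i : bary A (p r i) 0 i = bary A c 0 i - r * enorm (normal A i).
  rewrite (bary_normal A c) /p [c - _]addrC addrK; congr (_ + _).
  transitivity (- (r / enorm (normal A i)) * enorm (normal A i) ^+ 2).
    rewrite sqr_enorm mulr_sumr; apply: eq_bigr => j _.
    by rewrite !mxE; ring.
  by rewrite mulNr expr2 mulrA divfK ?gt_eqF.
have bary_ge r x i : esphere c r x ->
    bary A c 0 i - r * enorm (normal A i) <= bary A x 0 i.
  move=> xr; rewrite (bary_normal A c x) lerD2l.
  by have [] := enorm_dot _ (normal A i) r xr (N0 i).
split=> [[r [r0 sub touch]]|[r r0 bc]].
  exists r => // i; apply/eqP; rewrite eq_le; apply/andP; split.
    have [q Fq] := touch i.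
    have [qs /facetP[//|_ q0]] : (esphere c r `&` facet A i) q by rewrite Fq.
    by rewrite -subr_le0 -q0; exact: bary_ge.
  rewrite -subr_ge0 -bary_p.
  by have /simplexP := sub _ (p_sphere r i r0); apply.
exists r; split=> // [x xr|i].
  by apply/simplexP => // i; have := bary_ge r x i xr; rewrite bc subrr.
exists (p r i); apply/seteqP; split=> [x [xr /facetP[//|_ xi]]|_ ->] /=.
  have [_ eqc] := enorm_dot (x - c) (normal A i) r xr (N0 i).
  have := bary_normal A c x i; rewrite xi bc => /esym/eqP.
  rewrite addrC addr_eq0 => /eqP dE; have /eqP := eqc r0 dE.
  by rewrite subr_eq => /eqP ->; rewrite /p addrC scaleNr.
split; first exact: p_sphere.
apply/facetP => //; split=> [j|]; last by rewrite bary_p bc subrr.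
by have := bary_ge r (p r i) j (p_sphere r i r0); rewrite bc subrr.
Qed.

(** * Squared facet volumes *)

Lemma rpred_det {R : comPzRingType} (k : subringClosed R) {n : nat} (M : 'M[R]_n) :
  (forall i j, M i j \in k) -> \det M \in k.
Proof.
move=> Mk; apply: rpred_sum => s _.
by rewrite rpredMsign; apply: rpred_prod => i _.
Qed.

Lemma rpred_invmx {R : comUnitRingType} (k : divringClosed R) {n : nat}
    (M : 'M[R]_n) :
  (forall i j, M i j \in k) -> forall i j, invmx M i j \in k.
Proof.
move=> Mk i j; rewrite /invmx; case: ifP => // _; rewrite !mxE.
rewrite rpredM ?rpredV ?rpred_det // /cofactor rpredM ?rpredX ?rpredN1 //.
by apply: rpred_det => i' j'; rewrite !mxE.
Qed.

Lemma bary_in {R : realType} (k : divringClosed R) {n : nat}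
    (A : 'I_n.+1 -> 'rV[R]_n) (x : 'rV[R]_n) (i : 'I_n.+1) :
  (forall i, coords_in k (A i)) -> coords_in k x -> bary A x 0 i \in k.
Proof.
have row_in (y : 'rV[R]_n) (j : 'I_n.+1) : coords_in k y ->
    (row_mx (1%:M : 'M[R]_1) y : 'rV[R]_n.+1) 0 j \in k.
  move=> yk; case: (@split_ordP 1 n j) => l ->.
    by rewrite (@row_mxEl _ 1 1 n) mxE rpredMn ?rpred1.
  by rewrite (@row_mxEr _ 1 1 n).
move=> Ak xk; rewrite mxE rpred_sum // => j _; rewrite rpredM ?row_in //.
by apply: rpred_invmx => i' j'; rewrite mxE row_in.
Qed.

(** Entry [j] is the difference of the [i]-th barycentric coordinates of the [j]-th unit vector and
    of the origin, both points of [k^n]. *)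
Lemma normal_in {R : realType} (k : divringClosed R) {n : nat}
    (A : 'I_n.+1 -> 'rV[R]_n) (i : 'I_n.+1) :
  (forall i, coords_in k (A i)) -> coords_in k (normal A i).
Proof.
move=> Ak j.
have := bary_normal A 0 (delta_mx 0 j) i.
rewrite subr0 (bigD1 j) //= [delta_mx _ _ _ _]mxE !eqxx mul1r.
rewrite big1 ?addr0 => [|l lj]; last by rewrite [delta_mx _ _ _ _]mxE (negbTE lj) mul0r.
move/eqP; rewrite addrC -subr_eq => /eqP <-.
have dk (b : bool) : b%:R \in k by case: b; rewrite ?rpred1 ?rpred0.
by rewrite rpredB // bary_in // => l; rewrite mxE ?dk ?rpred0.
Qed.

(** [det_gram] applies with [g] the gradient of the [i]-th coordinate and [H] the gradients
    belonging to the facet vertices other than its base point; its hypotheses hold because a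
    coordinate is 1 at its own vertex and 0 at the others. *)
Lemma sqr_volume_facet {R : realType} {m : nat} (A : 'I_m.+3 -> 'rV[R]_m.+2)
    (i : 'I_m.+3) (a : R) :
  affinely_independent A -> has_volume m.+1 (facet A i) a ->
  let M : 'M[R]_m.+2 := col_mx (A i - A (lift i ord0))
                               (edge_mx (fun j => A (lift i j))) in
  \det M != 0 /\ a ^+ 2 = (\det M / (m.+1)`!%:R * enorm (normal A i)) ^+ 2.
Proof.
move=> hA vol M; set E := edge_mx _ in M *.
pose G := bary_grad A.
pose H : 'M[R]_(m.+2, m.+1) := \matrix_(r, j) G r (lift i (lift ord0 j)).
have AG j l t : \sum_r (A j - A l) 0 r * G r t = (t == j)%:R - (t == l)%:R.
  have := bary_normal A (A l) (A j) t; rewrite !bary_vertex // !mxE eqxx /= => ->.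
  by rewrite [RHS]addrC addKr; apply: eq_bigr => r _; rewrite !mxE.
have dg : (A i - A (lift i ord0)) *m col i G = 1%:M.
  apply/matrixP => x y; rewrite !ord1 mxE; under eq_bigr do rewrite [col _ _ _ _]mxE.
  by rewrite AG eqxx (negbTE (neq_lift i ord0)) subr0 mxE.
have EG j t : \sum_r E j r * G r t =
    (t == lift i (lift ord0 j))%:R - (t == lift i ord0)%:R.
  by rewrite -AG; apply: eq_bigr => r _; rewrite mxE.
have Eg : E *m col i G = 0.
  apply/matrixP => x y; rewrite !mxE; under eq_bigr do rewrite [col _ _ _ _]mxE.
  by rewrite EG !(negbTE (neq_lift i _)) subr0.
have EH : E *m H = 1%:M.
  apply/matrixP => x y; rewrite !mxE; under eq_bigr do rewrite [H _ _]mxE.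
  rewrite EG (inj_eq (@lift_inj _ i)) (inj_eq (@lift_inj _ ord0)) [y == x]eq_sym.
  by rewrite (inj_eq (@lift_inj _ i)) [_ == ord0]eq_sym (negbTE (neq_lift _ _)) subr0.
have [Mu detE] := det_gram _ _ _ _ dg Eg EH.
split; first by move: Mu; rewrite unitmxE unitfE.
rewrite (sqr_volume_simplex _ H a EH vol) -/E detE -/M.
rewrite !exprMn exprVn sqr_enorm mulrAC; congr (_ * _ * _).
by rewrite mxE; apply: eq_bigr => r _; rewrite !mxE expr2.
Qed.

(** * Square classes and the equivalence of the conditions *)

Lemma eq_mod_squaresP {R : realType} (k : divringClosed R) (p q x y : R) :
  p \in k -> q \in k -> p != 0 -> q != 0 -> 0 < x -> 0 < y ->
  eq_mod_squares k ((p * x) ^+ 2) ((q * y) ^+ 2) <-> x / y \in k.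
Proof.
move=> pk qk p0 q0 x0 y0.
have xy0 : x / y != 0 by rewrite gt_eqF // divr_gt0.
have pq0 : p / q != 0 by rewrite mulf_neq0 ?invr_eq0.
have pqk : p / q \in k by rewrite rpred_div.
have sqE : (p * x) ^+ 2 / (q * y) ^+ 2 = (p / q * (x / y)) ^+ 2.
  by rewrite -expr_div_n invfM mulrACA.
split=> [[s [sk s0]]|xyk]; last first.
  by exists (p / q * (x / y)); [split; [rewrite rpredM|rewrite mulf_neq0]|rewrite sqE].
rewrite sqE => /eqP; rewrite eqf_sqr => sE.
(* The square root is known only up to sign, which [k] absorbs. *)
rewrite -(mulKf pq0 (x / y)) rpredM ?rpredV //.
by case/orP: sE => /eqP sE; [rewrite -sE|rewrite -rpredN -sE].
Qed.

Theorem theorem1p8 (R : realType) (n : nat) (hn : (2 <= n)%N)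
    (k : divringClosed R) (A : 'I_n.+1 -> 'rV[R]_n)
    (hA : affinely_independent A) (hAk : forall i, coords_in k (A i))
    (a : 'I_n.+1 -> R) (ha : forall i, has_volume n.-1 (facet A i) (a i)) :
  let S1 := exists I : 'rV[R]_n, is_incenter A I /\ coords_in k I in
  let S2 := forall i j, eq_mod_squares k (a i ^+ 2) (a j ^+ 2) in
  let S2' := exists d : R, [/\ ring_of_integers k d, 0 < d &
    forall i, eq_mod_squares k (a i ^+ 2) d] in
  [/\ forall i, a i ^+ 2 \in k /\ a i ^+ 2 != 0,
      S1 <-> S2 &
      algebraic_over_Q k -> (S1 <-> S2') /\ (S2 <-> S2')].

Proof.
case: n hn A hA hAk a ha => [|[|m]] // _ A hA hAk a ha S1 S2 S2'.
pose c i := enorm (normal A i).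
have c_gt0 i : 0 < c i by apply: enorm_gt0; exact: normal_neq0.
(* Each [a i] equals [q i * c i] up to sign with [q i] in [k], so [a i ^+ 2] and [c i ^+ 2] have the
   same square class. *)
have [q qP] : {q : 'I_m.+3 -> R &
    forall i, [/\ q i \in k, q i != 0 & a i ^+ 2 = (q i * c i) ^+ 2]}.
  apply: (@choice _ _ (fun i r => [/\ r \in k, r != 0 & a i ^+ 2 = (r * c i) ^+ 2])) => i.
  have [d0 aE] := sqr_volume_facet A i (a i) hA (ha i).
  set M := col_mx _ _ in d0 aE.
  exists (\det M / (m.+1)`!%:R); split=> //.
    rewrite rpred_div ?rpred_nat // rpred_det // => r s.
    rewrite /M; case: (@split_ordP 1 m.+1 r) => r' ->.
      by rewrite (@col_mxEu _ 1 m.+1) (ord1 r') !mxE rpredB //; exact: hAk.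
    by rewrite (@col_mxEd _ 1 m.+1) !mxE rpredB //; exact: hAk.
  by rewrite mulf_neq0 // invr_eq0 pnatr_eq0 -lt0n fact_gt0.
have ak i : a i ^+ 2 \in k.
  have [qk _ ->] := qP i; rewrite exprMn rpredM //; first by rewrite rpredX.
  by rewrite sqr_enorm; apply: rpred_sum => j _; rewrite rpredX // normal_in.
have a0 i : a i ^+ 2 != 0.
  by have [_ q0 ->] := qP i; rewrite expf_neq0 // mulf_neq0 // gt_eqF.
have S2E : S2 <-> forall i j, c i / c j \in k.
  split=> H i j; have [qi qi0 aiE] := qP i; have [qj qj0 ajE] := qP j.
    apply/(eq_mod_squaresP _ _ _ _ _ qi qj qi0 qj0 (c_gt0 i) (c_gt0 j)).
    by rewrite -aiE -ajE; exact: H.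
  by rewrite aiE ajE; apply/(eq_mod_squaresP _ _ _ _ _ qi qj qi0 qj0 (c_gt0 i) (c_gt0 j)).
have S1E : S1 <-> forall i j, c i / c j \in k.
  split=> [[I [/(is_incenterP _ _ hA) [r r0 bI] Ik]] i j|ck].
    have -> : c i / c j = bary A I 0 i / bary A I 0 j.
      by rewrite !bI -mulf_div divff ?gt_eqF // mul1r.
    by rewrite rpred_div // bary_in.
  pose s := \sum_i c i.
  have s0 : 0 < s.
    by rewrite /s big_ord_recl ltr_pwDl // sumr_ge0 // => i _; exact: ltW.
  (* The inverse [s / c i] is the sum of the ratios [c j / c i], all in [k]. *)
  have csk i : c i / s \in k.
    by rewrite -[c i / s]invrK rpredV invfM invrK mulrC mulr_suml rpred_sum.
  have cs1 : \sum_i c i / s = 1 by rewrite -mulr_suml divff // gt_eqF.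
  exists (\sum_i (c i / s) *: A i); split; last first.
    move=> j; rewrite summxE rpred_sum // => i _; rewrite mxE rpredM ?csk //.
    exact: hAk.
  apply/(is_incenterP _ _ hA); exists s^-1; first by rewrite invr_gt0.
  by move=> i; rewrite bary_sum // mxE mulrC.
split=> [i||algk]; [by split; [exact: ak|exact: a0]|by rewrite S1E S2E|].
suff S2S2' : S2 <-> S2' by split=> //; rewrite S1E -S2E.
split=> [H|[d [_ d0 H]] i j]; last first.
  have [x [xk x0] xE] := H i; have [y [yk y0] yE] := H j.
  exists (x / y); first by split; [rewrite rpred_div|rewrite mulf_neq0 ?invr_eq0].
  by rewrite expr_div_n xE yE invfM invrK mulrA mulrAC divfK // gt_eqF.
have [N N0 Nint] := exists_integral_multiple _ (algk _ (ak ord0)).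
(* One factor [N] makes [a ord0 ^+ 2] integral; the second keeps it integral and restores the square
   class. *)
exists (N%:~R ^+ 2 * a ord0 ^+ 2); split.
- split; first by rewrite rpredM ?ak // rpredX // rpred_int.
  rewrite expr2 -mulrA; apply: integral_mul => //; exact: integral_id.
- by rewrite mulr_gt0 // lt_def sqr_ge0 ?a0 ?expf_neq0 ?intr_eq0.
move=> i; have [x [xk x0] xE] := H i ord0.
exists (x / N%:~R).
  by split; [rewrite rpred_div ?rpred_int|rewrite mulf_neq0 ?invr_eq0 ?intr_eq0].
by rewrite expr_div_n xE -mulrA -invfM [X in _ / X]mulrC.
Qed.
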